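(* Let $q$ be an even prime power (that is, $q=2^k$ with $k\ge 1$), let $\theta_q=\frac{\phi(q-1)}{q-1}$, and let $\ell$ be the least prime divisor of $q-1$. If $\theta_q<\frac{8}{9}$, then $\mathbb{F}_q$ contains an $\mathrm{NT}\ell$ pair, except when $q=4$, $q=8$ or $q=16$ (in these three cases no such pair exists).
   Context: $\phi$ denotes Euler's totient function and $\mathbb{F}_q$ the finite field with $q$ elements. For a prime divisor $\ell$ of $q-1$, a non-trivial $\ell$th power is an element of $\mathbb{F}_q\setminus\{0,1\}$ of the form $\gamma^\ell$ with $\gamma\in\mathbb{F}_q$. An $\mathrm{NT}\ell$ pair is a pair $(\beta,\beta+1)$ with $\beta\in\mathbb{F}_q$ such that both $\beta$ and $\beta+1$ are non-trivial $\ell$th powers. *)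

(* Defs.v *)
From HB Require Import structures.
From mathcomp Require Import all_boot all_order all_algebra all_field.

Set Implicit Arguments.
Unset Strict Implicit.
Unset Printing Implicit Defensive.

Import Order.TTheory GRing.Theory Num.Theory.

Local Open Scope ring_scope.

Definition theta (q : nat) : rat := (totient (q - 1))%:R / (q - 1)%:R.

Definition nontrivial_power (F : finFieldType) (l : nat) (x : F) : Prop :=
  [/\ x != 0, x != 1 & exists g : F, x = g ^+ l].

Definition NT_pair (F : finFieldType) (l : nat) (p : F * F) : Prop :=
  [/\ p.2 = p.1 + 1, nontrivial_power l p.1 & nontrivial_power l p.2].

(* Main.v *)
Require Import Defs.
From HB Require Import structures.
From mathcomp Require Import all_boot all_order all_algebra all_field.
From mathcomp Require Import all_solvable.
From mathcomp Require Import zify ring lra.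

Set Implicit Arguments.
Unset Strict Implicit.
Unset Printing Implicit Defensive.

Import Order.TTheory GRing.Theory Num.Theory.

Local Open Scope ring_scope.

(**
For k = 1 theta is 1, so let k >= 2 and write l for the least prime divisor of
2^k - 1, which is odd. By Fermat's little theorem l divides
2^(l-1) - 1, hence also Q - 1 with Q = 2^d and d = gcd (k, l - 1)
([prime_dvd_pow2_gcd]). So F is the extension of degree r = k / d of the field
with Q elements, and an l-th power can be obtained as a (Q - 1)-th power. The
value of r decides the argument.

If r >= 4, then l < Q is so small compared with q = Q^r that solutions of
a^l + b^l = c^l with abc <> 0 exist by a Fourier argument
([fermat_sum_solvable]), and dividing by c^l gives the pair. The additive
characters of a field of characteristic two take the values 1 and -1, so the
whole argument is about integers. With S(t) the sum of psi (t a^l) over nonzero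
a, the third moment of S counts the solutions; its main term S(0)^3 = (q - 1)^3
cannot be cancelled by the other terms, because the second moment is at most
q (q - 1) l, and because S is constant on the cosets of l-th powers, so that one
large value at t <> 0 would be repeated often and spoil that bound.

If r = 3, a root x of X^Q (X + 1) = 1 works ([exists_NT_pair_cubic]). On such
an x the Q-th power Frobenius acts as the homography x -> 1 / (x + 1), which has
order three and permutes 0, 1 and infinity cyclically. Order three puts x in F,
and the permutation makes the norms of x and x + 1 to the field with Q elements
equal to 1, so that x and x + 1 are (Q - 1)-th powers.

If r <= 2 and k is even, then l = 3 and d = 2, so q is 4 or 16. If r <= 2 and k
is odd, then r = 1, that is, k divides l - 1, and l > 2k because l - 1 is even.
Then 2^k - 1 has few prime divisors, all of them large, and theta is at least
8/9 unless k = 3 ([theta_ge_of_order]): this is where the hypothesis on theta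
enters.

In the fields with 4 and 8 elements 1 is the only nonzero l-th power, and in the
field with 16 elements a short computation excludes a pair of cubes.
*)

(** * Pairs of powers *)

(** In characteristic two x = 1 is the same as x + 1 = 0, so asking that x and
    x + 1 be nonzero already makes both of them non-trivial. *)
Lemma NT_pair_of_powers (F : finFieldType) (l : nat) (x g h : F) :
    2%N \in [pchar F] -> x != 0 -> x + 1 != 0 -> x = g ^+ l -> x + 1 = h ^+ l ->
  NT_pair l (x, x + 1).
Proof.
move=> F2 x0 x1 xg xh; split=> //; split=> //=.
- by apply: contraNneq x1 => ->; rewrite (addrr_pchar2 F2).
- by exists g.
- by rewrite -subr_eq0 addrK.
- by exists h.
Qed.

Lemma expf_card_pred (F : finFieldType) (x : F) : x != 0 -> x ^+ #|F|.-1 = 1.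
Proof.
move=> x0; apply: (mulIf x0); rewrite mul1r -exprSr prednK ?expf_card //.
exact: ltnW (card_finRing_gt1 F).
Qed.

(** The unit group is cyclic: x is a power z ^+ i of a generator z, and
    x ^+ e = 1 forces f to divide i. *)
Lemma exists_root_of_unity_exp (F : finFieldType) (e f : nat) (x : F) :
  #|F|.-1 = (e * f)%N -> x ^+ e = 1 -> exists g : F, x = g ^+ f.
Proof.
move=> card_eq xe.
have n0 : (0 < e * f)%N by rewrite -card_eq -subn1 subn_gt0 card_finRing_gt1.
have : has (e * f).-primitive_root (enum [set x : F | x != 0]).
  apply: has_prim_root => //; last 1 first.
  - rewrite -cardE cardsE -card_eq (cardC1 (0 : F)) //.
  - apply/allP => y; rewrite mem_enum inE unity_rootE => y0.
    by rewrite -card_eq expf_card_pred.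
  - exact: enum_uniq.
case/hasP => z _ z_prim.
have [|i x_eq] := prim_rootP z_prim (x := x); first by rewrite exprM xe expr1n.
have : (e * f %| e * i)%N.
  by rewrite (prim_order_dvd z_prim) mulnC exprM -x_eq xe.
rewrite dvdn_pmul2l; last by move: n0; rewrite muln_gt0 => /andP[].
by case/dvdnP => j i_eq; exists (z ^+ j); rewrite x_eq i_eq exprM.
Qed.

(** * Character sums over Fermat equations in characteristic two *)

Lemma card_root_power (F : finFieldType) (l : nat) (c : F) :
  (0 < l)%N -> (#|[set x : F | x ^+ l == c]| <= l)%N.
Proof.
move=> l0; rewrite -ltnS cardE -(size_XnsubC c l0).
apply: max_poly_roots; last exact: enum_uniq.
  by rewrite -size_poly_eq0 size_XnsubC.
by apply/allP => x; rewrite mem_enum inE rootE !hornerE subr_eq0.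
Qed.

(** The character is (-1) to the absolute trace. The trace takes its values in
    {0, 1} because it is fixed by squaring, and it does not vanish identically
    because it is a nonzero polynomial of degree at most 2 ^ (k - 1) < #|F|. *)
Lemma exists_additive_character (F : finFieldType) (k : nat) :
    (0 < k)%N -> #|F| = (2 ^ k)%N ->
  exists psi : F -> int,
    [/\ psi 0 = 1, {morph psi : x y / x + y >-> x * y}
      & exists x, psi x != 1].
Proof.
move=> k0 cF; have F2 : 2%N \in [pchar F] by apply: (card_finPcharP cF).
pose tr (x : F) := \sum_(i < k) x ^+ (2 ^ i).
have sqrD (x y : F) i : (x + y) ^+ (2 ^ i) = x ^+ (2 ^ i) + y ^+ (2 ^ i).
  by rewrite exprDn_pchar // pnatX pnatE ?F2.
have trD x y : tr (x + y) = tr x + tr y.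
  by rewrite -big_split; apply: eq_bigr => i _; apply: sqrD.
have tr_sqr x : tr x ^+ 2 = tr x.
  case: k k0 cF @tr trD => // k _ cF tr trD.
  have -> : tr x ^+ 2 = \sum_(i < k.+1) x ^+ (2 ^ i.+1).
    rewrite /tr -(expn1 2); elim/big_rec2: _ => [|i y z _ <-].
      by rewrite expr0n.
    by rewrite sqrD expn1 -exprM -expnSr.
  by rewrite /tr [RHS]big_ord_recl big_ord_recr /= -cF expf_card expn0 expr1 addrC.
have tr01 x : tr x = 0 \/ tr x = 1.
  have [-> | nz] := eqVneq (tr x) 0; [by left | right].
  by apply: (mulfI nz); rewrite mulr1 -expr2 tr_sqr.
exists (fun x => (-1) ^+ (tr x != 0)); split.
- by rewrite /tr big1 ?eqxx // => i _; rewrite expr0n expn_eq0.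
- move=> x y; rewrite trD.
  have [-> | ->] := tr01 x; have [-> | ->] := tr01 y;
  by rewrite ?addr0 ?add0r ?(addrr_pchar2 F2) ?eqxx ?oner_eq0.
pose p : {poly F} := \sum_(i < k) 'X^(2 ^ i).
have p_nz : p != 0.
  apply/eqP => /(congr1 (fun p : {poly F} => p`_1)) /eqP.
  rewrite coef0 coef_sum (bigD1 (Ordinal k0)) //= coefXn eqxx big1 ?addr0 ?oner_eq0 //.
  move=> [[|i] lt_i] //= _; rewrite coefXn; case: eqP => // /eqP.
  by rewrite -{1}(expn0 2) eqn_exp2l.
have size_p : (size p <= (2 ^ k.-1).+1)%N.
  apply: (leq_trans (size_sum _ _ _)); apply/bigmax_leqP => i _.
  by rewrite size_polyXn ltnS leq_exp2l // -ltnS prednK.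
(* If the trace vanished on F, it would have more roots than its degree. *)
case: (pickP (fun x => tr x != 0)) => [x nz|tr0].
  by exists x; rewrite nz.
have : (size (enum F) < size p)%N.
  apply: max_poly_roots => //; last exact: enum_uniq.
  apply/allP => x _; move: (tr0 x) => /negbFE; rewrite rootE horner_sum.
  by congr (_ == 0); apply: eq_bigr => i _; rewrite hornerXn.
rewrite -cardE cF => /leq_trans /(_ size_p).
by rewrite -{1}(prednK k0) ltnS expnS leqNgt ltn_Pmull ?expn_gt0.
Qed.

Section FermatEquation.

Variables (F : finFieldType) (l : nat).
Hypotheses (F2 : 2%N \in [pchar F]) (l_gt0 : (0 < l)%N).
Variable psi : F -> int.
Hypotheses (psi0 : psi 0 = 1) (psiD : {morph psi : x y / x + y >-> x * y}).
Hypothesis psi_nontrivial : exists x, psi x != 1.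

Let q : int := #|F|%:R.

Lemma sum_character (x : F) : \sum_t psi (t * x) = q * (x == 0)%:R.
Proof.
have [-> | nz] := eqVneq x 0.
  under eq_bigr do rewrite mulr0 psi0.
  by rewrite mulr1 sumr_const.
have [y psi_y] := psi_nontrivial.
rewrite mulr0 (reindex_inj (mulIf (invr_neq0 nz))) /=.
under eq_bigr do rewrite divfK //.
set s := \sum_t _; apply/eqP.
suff: s * (1 - psi y) == 0 by rewrite mulf_eq0 subr_eq0 [1 == _]eq_sym (negPf psi_y) orbF.
rewrite mulrBr mulr1 subr_eq0; apply/eqP.
(* Shifting t by y multiplies the sum by psi y, which differs from 1. *)
rewrite {1}/s (reindex_inj (addIr y)) /= mulr_suml.
by apply: eq_bigr => t _.
Qed.

(** The sum runs over all nonzero a, so every l-th power is counted with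
    multiplicity and the estimates rest only on the bound l for the number of
    l-th roots of an element. *)
Definition power_char_sum (t : F) : int := \sum_(a : F | a != 0) psi (t * a ^+ l).

Lemma sum_nonzero : \sum_(a : F | a != 0) 1 = q - 1.
Proof.
have -> : q = \sum_(a : F) 1 by rewrite sumr_const.
by rewrite [in RHS](bigD1 0) //= addrAC subrr add0r.
Qed.

Lemma power_char_sum0 : power_char_sum 0 = q - 1.
Proof.
rewrite /power_char_sum; under eq_bigr do rewrite mul0r psi0.
exact: sum_nonzero.
Qed.

Lemma power_char_sum_scale (t g : F) : g != 0 -> power_char_sum (t * g ^+ l) = power_char_sum t.
Proof.
move=> g0; rewrite /power_char_sum [RHS](reindex_inj (mulfI g0)) /=.
apply: eq_big => [a | a _]; first by rewrite mulf_eq0 (negPf g0).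
by rewrite exprMn mulrA.
Qed.

Lemma second_moment_eq :
  \sum_t power_char_sum t ^+ 2 =
  \sum_(a : F | a != 0) \sum_(b : F | b != 0) q * (a ^+ l + b ^+ l == 0)%:R.
Proof.
under [RHS]eq_bigr => a _ do under eq_bigr => b _ do rewrite -sum_character.
under [RHS]eq_bigr => a _ do rewrite exchange_big.
rewrite [RHS]exchange_big; apply: eq_bigr => t _.
rewrite expr2 big_distrlr /=.
by apply: eq_bigr => a _; apply: eq_bigr => b _; rewrite mulrDr psiD.
Qed.

(** Orthogonality in t turns the third moment into a multiple of the number of
    solutions of the Fermat equation in nonzero a, b, c. *)
Lemma third_moment_eq :
  \sum_t power_char_sum t ^+ 3 =
  \sum_(a : F | a != 0) \sum_(b : F | b != 0) \sum_(c : F | c != 0)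
    q * (a ^+ l + b ^+ l + c ^+ l == 0)%:R.
Proof.
under [RHS]eq_bigr => a _ do under eq_bigr => b _ do
  under eq_bigr => c _ do rewrite -sum_character.
under [RHS]eq_bigr => a _ do under eq_bigr => b _ do rewrite exchange_big.
under [RHS]eq_bigr => a _ do rewrite exchange_big.
rewrite [RHS]exchange_big; apply: eq_bigr => t _.
rewrite exprSr expr2 big_distrlr mulr_suml /=.
apply: eq_bigr => a _; rewrite mulr_suml.
apply: eq_bigr => b _; rewrite mulr_sumr.
by apply: eq_bigr => c _; rewrite !mulrDr !psiD.
Qed.

(** For fixed a, the equation b ^+ l = - a ^+ l has at most l roots b. *)
Lemma second_moment_le :
  \sum_t power_char_sum t ^+ 2 <= q * ((q - 1) * l%:R).
Proof.
rewrite second_moment_eq -sum_nonzero mulr_suml mulr_sumr; apply: ler_sum => a _.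
rewrite mul1r -mulr_sumr ler_wpM2l ?ler0n //.
apply: (@le_trans _ _ (#|[set b : F | b ^+ l == a ^+ l]|%:R)); last first.
  by rewrite ler_nat card_root_power.
rewrite -sumr_const big_mkcond [leRHS]big_mkcond /=.
apply: ler_sum => b _; rewrite inE addr_eq0 (oppr_pchar2 F2) [b ^+ l == _]eq_sym.
by case: ifP => _; case: (_ == _).
Qed.

(** The value at t is repeated at every t * g ^+ l. As g runs through the
    nonzero elements each such point is met at most l times, so (q - 1) times
    the square of the value is at most l times the second moment. *)
Lemma power_char_sum_le (t : F) : t != 0 -> power_char_sum t ^+ 2 <= l%:R ^+ 2 * q.
Proof.
move=> t0.
have q_gt1 : 0 < q - 1 by rewrite subr_gt0 ltr1n card_finRing_gt1.
rewrite -(ler_pM2l q_gt1).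
apply: (@le_trans _ _ (l%:R * \sum_s power_char_sum s ^+ 2)); last first.
  apply: le_trans (ler_wpM2l (ler0n _ _) second_moment_le) _.
  by lra.
rewrite -{1}sum_nonzero mulr_suml (partition_big (fun g => t * g ^+ l) xpredT) //= mulr_sumr.
apply: ler_sum => s _.
apply: (@le_trans _ _ (\sum_(g in [set g : F | g ^+ l == t^-1 * s]) power_char_sum s ^+ 2)).
  rewrite big_mkcond [leRHS]big_mkcond /=; apply: ler_sum => g _; rewrite inE.
  have [<- | ne] := eqVneq (t * g ^+ l) s.
    rewrite andbT mulKf // eqxx mul1r.
    by case: ifP => [g0 | _]; rewrite ?sqr_ge0 // power_char_sum_scale.
  by rewrite andbF; case: ifP; rewrite ?lexx ?sqr_ge0.
by rewrite sumr_const -[leLHS]mulr_natl ler_wpM2r ?sqr_ge0 // ler_nat card_root_power.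
Qed.

(** The term at t = 0 is (q - 1) ^+ 3, while the others add up to at most m times
    the second moment, m being the largest absolute value of the sum at t != 0.
    If they cancelled, then (q - 1) ^+ 2 <= m * q * l; squaring this replaces m,
    of order the square root of q, by the integer bound on m ^+ 2. *)
Lemma third_moment_neq0 : (l ^ 4 * #|F| ^ 3 < (#|F| - 1) ^ 4)%N ->
  \sum_t power_char_sum t ^+ 3 != 0.
Proof.
move=> big_q; apply/eqP.
have q_gt1 : 0 < q - 1 by rewrite subr_gt0 ltr1n card_finRing_gt1.
rewrite (bigD1 0) //= power_char_sum0 => /eqP; rewrite addr_eq0 => /eqP cubes.
case: (@Order.TotalTheory.arg_maxP _ int F 1 (fun t => t != 0) (fun t => `|power_char_sum t|)).
  exact: oner_neq0.
move=> t0 t0_nz max_t0; set m := `|power_char_sum t0| in max_t0.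
have m_ge0 : 0 <= m by apply: normr_ge0.
have m_sqr : m ^+ 2 <= l%:R ^+ 2 * q by rewrite real_normK ?num_real // power_char_sum_le.
have le1 : (q - 1) ^+ 3 <= m * (q * ((q - 1) * l%:R)).
  apply: le_trans (ler_wpM2l m_ge0 second_moment_le).
  rewrite cubes -sumrN [leRHS](_ : _ = m * power_char_sum 0 ^+ 2 +
     \sum_(t | t != 0) m * power_char_sum t ^+ 2); last first.
    by rewrite (bigD1 0) //= mulrDr mulr_sumr.
  rewrite ler_wpDl // ?(mulr_ge0 m_ge0 (sqr_ge0 _)) //; apply: ler_sum => t t_nz.
  apply: le_trans (ler_norm _) _; rewrite normrN exprS normrM normrX.
  by rewrite real_normK ?num_real // ler_wpM2r ?sqr_ge0 //; apply: max_t0.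
have le2 : (q - 1) ^+ 2 <= m * q * l%:R.
  by rewrite -(ler_pM2l q_gt1) -exprS; apply: le_trans le1 _; lra.
have le3 : (q - 1) ^+ 4 <= l%:R ^+ 4 * q ^+ 3.
  rewrite [leLHS](_ : _ = ((q - 1) ^+ 2) ^+ 2); last by ring.
  apply: (@le_trans _ _ ((m * q * l%:R) ^+ 2)).
    by rewrite ler_sqr ?nnegrE ?sqr_ge0 ?mulr_ge0 ?ler0n.
  rewrite [leLHS](_ : _ = q ^+ 2 * l%:R ^+ 2 * m ^+ 2); last by ring.
  apply: le_trans (ler_wpM2l _ m_sqr) _; first by rewrite mulr_ge0 ?sqr_ge0.
  by lra.
have q1 : q - 1 = (#|F| - 1)%:R by rewrite natrB // (ltnW (card_finRing_gt1 F)).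
by move: le3; rewrite q1 -!natrX -natrM ler_nat leqNgt big_q.
Qed.

End FermatEquation.

Lemma fermat_sum_solvable (F : finFieldType) (k l : nat) :
    (0 < k)%N -> #|F| = (2 ^ k)%N -> (0 < l)%N ->
    (l ^ 4 * #|F| ^ 3 < (#|F| - 1) ^ 4)%N ->
  exists a b c : F, [/\ a != 0, b != 0, c != 0 & a ^+ l + b ^+ l = c ^+ l].
Proof.
move=> k0 cF l0 big_q; have F2 : 2%N \in [pchar F] by apply: (card_finPcharP cF).
have [psi [psi0 psiD psi1]] := exists_additive_character k0 cF.
have := third_moment_neq0 F2 l0 psi0 psiD psi1 big_q.
rewrite (third_moment_eq l psi0 psiD psi1) => nz.
case: (pickP (fun u : F * F * F => [&& u.1.1 != 0, u.1.2 != 0, u.2 != 0 &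
    u.1.1 ^+ l + u.1.2 ^+ l + u.2 ^+ l == 0])) => [[[a b] c] /= /and4P[a0 b0 c0]|none].
  by rewrite addr_eq0 (oppr_pchar2 F2) => /eqP; exists a, b, c.
case/eqP: nz; rewrite big1 // => a a0; rewrite big1 // => b b0; rewrite big1 // => c c0.
by have := none (a, b, c); rewrite /= a0 b0 c0 /= => ->; rewrite mulr0.
Qed.

Lemma exists_NT_pair_large (F : finFieldType) (k l : nat) :
    (0 < k)%N -> #|F| = (2 ^ k)%N -> (0 < l)%N ->
    (l ^ 4 * #|F| ^ 3 < (#|F| - 1) ^ 4)%N ->
  exists p : F * F, NT_pair l p.
Proof.
move=> k0 cF l0 big_q; have F2 : 2%N \in [pchar F] by apply: (card_finPcharP cF).
have [a [b [c [a0 b0 c0 abc]]]] := fermat_sum_solvable k0 cF l0 big_q.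
have b_eq : (a / c) ^+ l + 1 = (b / c) ^+ l.
  apply: (mulIf (expf_neq0 l c0)).
  by rewrite mulrDl mul1r -!exprMn !divfK // -abc addrA (addrr_pchar2 F2) add0r.
exists ((a / c) ^+ l, (a / c) ^+ l + 1); apply: (NT_pair_of_powers F2 _ _ (erefl _) b_eq).
  by rewrite expf_neq0 // mulf_neq0 ?invr_eq0.
by rewrite b_eq expf_neq0 // mulf_neq0 ?invr_eq0.
Qed.

(** * Cubic extensions *)

(** The polynomial u = X^Q (X + 1) + 1 divides X^#|F| - X, which is the product of
    all X - x. Indeed modulo u the Q-th power map sends X to 1 / (X + 1), a
    homography of order three. *)
Lemma exists_norm_one_pair (F : finFieldType) (d : nat) (Q := (2 ^ d)%N) :
  #|F| = (Q ^ 3)%N -> exists x : F, x ^+ Q * (x + 1) = 1.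
Proof.
move=> cF.
have cF2 : #|F| = (2 ^ (d * 3))%N by rewrite cF /Q expnM.
have F2 : 2%N \in [pchar F] by apply: (card_finPcharP cF2).
have P2 : 2%N \in [pchar {poly F}] by rewrite pchar_poly.
have Q0 : (0 < Q)%N by rewrite expn_gt0.
have frob (y z : {poly F}) : (y + z) ^+ Q = y ^+ Q + z ^+ Q.
  by rewrite exprDn_pchar // pnatX pnatE ?P2.
pose a : {poly F} := 'X; pose b := a ^+ Q; pose c := b ^+ Q; pose e := c ^+ Q.
pose u := b * (a + 1) + 1.
have uQ : u ^+ Q = c * (b + 1) + 1 by rewrite /u frob exprMn frob !expr1n.
have uQQ : (u ^+ Q) ^+ Q = e * (c + 1) + 1 by rewrite uQ frob exprMn frob !expr1n.
have e_eq : e = 'X^#|F| by rewrite cF /e /c /b -!exprM !expnS muln1 mulnA.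
have u_dvd : u %| 'X^#|F| - 'X.
  (* With b, c, e the iterated Q-th powers of X, the polynomials u, u ^+ Q and
     u ^+ Q ^+ Q express that b, c, e are the inverses of X + 1, b + 1, c + 1;
     eliminating b and c leaves e = X. *)
  have -> : 'X^#|F| - 'X = u ^+ Q ^+ Q * a + e * (u ^+ Q * (a + 1) + c * u).
    rewrite -e_eq uQQ uQ /u -/a.
    have two0 : 2%:R = 0 :> {poly F} by apply/eqP; rewrite -(dvdn_pcharf P2).
    rewrite [RHS](_ : _ = e - a + 2%:R * (a + e * (c * a + a + c + c * b * (a + 1)))); last by ring.
    by rewrite two0 mul0r addr0.
  have dvd_exp n : (0 < n)%N -> u %| u ^+ n.
    by case: n => // n _; rewrite exprS dvdp_mulr.
  apply: dvdp_add; first by apply: dvdp_mulr; rewrite -exprM dvd_exp ?muln_gt0 ?Q0.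
  by apply/dvdp_mull/dvdp_add; [apply: dvdp_mulr; apply: dvd_exp | apply: dvdp_mull].
rewrite finField_genPoly in u_dvd.
have [m u_split] := dvdp_prod_XsubC u_dvd.
have size_u : (1 < size u)%N.
  have size_ba : size (b * (a + 1)) = Q.+2.
    rewrite size_mul ?monic_neq0 ?monicXn ?monicXaddC //.
    by rewrite size_polyXn size_XaddC addn2.
  by rewrite /u size_polyDl size_ba ?size_poly1.
case: (mask m _) u_split => [|x s] /= u_split.
  by rewrite (eqp_size u_split) big_nil size_poly1 in size_u.
exists x; have : root u x by rewrite (eqp_root u_split) big_cons rootM root_XsubC eqxx.
by rewrite rootE /u !hornerE addr_eq0 (oppr_pchar2 F2) => /eqP.
Qed.

(** The elements x, y, z below are the conjugates of x over the field with Q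
    elements. From y = 1 / (x + 1) and z = (x + 1) / x both x and x + 1 have
    norm 1 to that field, hence are (Q - 1)-th powers. *)
Lemma exists_NT_pair_cubic (F : finFieldType) (d l : nat) :
    (0 < d)%N -> #|F| = (2 ^ (3 * d))%N -> (l %| 2 ^ d - 1)%N ->
  exists p : F * F, NT_pair l p.
Proof.
move=> d0 cF l_dvd; have F2 : 2%N \in [pchar F] by apply: (card_finPcharP cF).
have cFQ : #|F| = ((2 ^ d) ^ 3)%N by rewrite cF mulnC expnM.
have [x] := exists_norm_one_pair cFQ; set Q := (2 ^ d)%N in cFQ l_dvd *.
have Q1 : (1 < Q)%N by rewrite -{1}(expn0 2) ltn_exp2l.
pose y := x ^+ Q; pose z := y ^+ Q => yx.
have zy : z * (y + 1) = 1.
  have := congr1 (fun t => t ^+ Q) yx.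
  by rewrite exprMn exprDn_pchar ?pnatX ?pnatE ?F2 // !expr1n.
have zx : z * x = x + 1.
  transitivity (z * (y + 1) * (x + 1)); last by rewrite zy mul1r.
  have -> : z * (y + 1) * (x + 1) = z * (y * (x + 1) + x + 1) by ring.
  by rewrite yx addrAC (addrr_pchar2 F2) add0r.
have x_norm : x ^+ (Q ^ 2 + Q + 1) = 1.
  rewrite !exprD expr1 -mulnn exprM -/y -/z.
  by rewrite mulrAC zx mulrC.
have x1_norm : (x + 1) ^+ (Q ^ 2 + Q + 1) = 1.
  have frob (t : F) : (t + 1) ^+ Q = t ^+ Q + 1.
    by rewrite exprDn_pchar ?pnatX ?pnatE ?F2 // expr1n.
  rewrite !exprD expr1 -mulnn exprM !frob -/y -/z; rewrite -/y in yx.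
  have yx_x : (y + 1) * (x + 1) = x.
    by rewrite mulrDl yx mul1r addrCA (addrr_pchar2 F2) addr0.
  by rewrite -mulrA yx_x mulrDl zx mul1r addrAC (addrr_pchar2 F2) add0r.
have x0 : x != 0.
  by apply: contra_eq_neq yx => ->; rewrite expr0n eqn0Ngt (ltnW Q1) mul0r eq_sym oner_neq0.
have x10 : x + 1 != 0 by apply: contra_eq_neq yx => ->; rewrite mulr0 eq_sym oner_neq0.
have card_eq : #|F|.-1 = ((Q ^ 2 + Q + 1) * (Q - 1))%N by rewrite cFQ; nia.
have power (t : F) : t ^+ (Q ^ 2 + Q + 1) = 1 -> exists g, t = g ^+ l.
  case/(exists_root_of_unity_exp card_eq) => g ->; case/dvdnP: l_dvd => m ->.
  by exists (g ^+ m); rewrite exprM.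
have [g xg] := power x x_norm; have [h xh] := power _ x1_norm.
by exists (x, x + 1); apply: NT_pair_of_powers xg xh.
Qed.

(** * Arithmetic of the exponent *)

(** With q = 2 ^ (r * d) = Q * P, where Q = 2 ^ d, the condition r >= 4 says
    q ^ 3 <= P ^ 4, so the left side is at most ((Q - 1) * P) ^ 4 = (q - P) ^ 4. *)
Lemma fourth_power_bound (d r l : nat) :
    (0 < d)%N -> (3 < r)%N -> (l %| 2 ^ d - 1)%N ->
  (l ^ 4 * (2 ^ (r * d)) ^ 3 < (2 ^ (r * d) - 1) ^ 4)%N.
Proof.
move=> d0 r3 l_dvd.
have Q1 : (1 < 2 ^ d)%N by rewrite -{1}(expn0 2) ltn_exp2l.
have l_le : (l <= 2 ^ d - 1)%N by rewrite dvdn_leq // subn_gt0.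
pose P := (2 ^ (r.-1 * d))%N.
have P1 : (1 < P)%N by rewrite /P -{1}(expn0 2) ltn_exp2l // muln_gt0 d0 -ltnS prednK; lia.
have q_eq : (2 ^ (r * d) = 2 ^ d * P)%N.
  by rewrite /P -expnD -mulSn prednK //; lia.
have q3 : ((2 ^ (r * d)) ^ 3 <= P ^ 4)%N.
  by rewrite /P -!expnM leq_exp2l //; nia.
apply: (@leq_ltn_trans (((2 ^ d - 1) * P) ^ 4)).
  by rewrite expnMn leq_mul // leq_exp2r.
by rewrite ltn_exp2r // q_eq mulnBl mul1n ltn_sub2l //; nia.
Qed.

Lemma pdiv_even_exponent (k : nat) : (0 < k)%N -> ~~ odd k -> pdiv (2 ^ k - 1) = 3%N.
Proof.
move=> k0 k_even; have dvd3 : (3 %| 2 ^ k - 1)%N.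
  have -> : (2 ^ k - 1 = (2 ^ 2) ^ k./2 - 1 ^ k./2)%N.
    by rewrite exp1n -expnM mul2n even_halfK.
  by rewrite subn_exp dvdn_mulr.
have := pdiv_min_dvd (isT : 1 < 3)%N dvd3.
have q1 : (1 < 2 ^ k - 1)%N.
  rewrite ltn_subRL -[(1 + 1)%N]/(2 ^ 1)%N ltn_exp2l //.
  by case: k k0 k_even {dvd3} => [|[|k]].
have : odd (pdiv (2 ^ k - 1)).
  by apply: dvdn_odd (pdiv_dvd _) _; rewrite oddB ?expn_gt0 // oddX eqn0Ngt k0.
by have := prime_gt1 (pdiv_prime q1); case: (pdiv _) => [|[|[|[|]]]].
Qed.

(** The exponents n with 2 ^ n = 1 modulo l are closed under gcd, and l.-1 is one
    of them by Fermat's little theorem. *)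
Lemma prime_dvd_pow2_gcd (l k : nat) :
    prime l -> odd l -> (l %| 2 ^ k - 1)%N ->
  (l %| 2 ^ gcdn k l.-1 - 1)%N.
Proof.
move=> l_pr l_odd; rewrite -!eqn_mod_dvd ?expn_gt0 // => /eqP pow_k.
have pow_l : 2 ^ l.-1 = 1 %[mod l].
  rewrite -totient_prime //; apply: Euler_exp_totient.
  by rewrite coprime2n.
have [k0 | k0] := posnP k; first by rewrite k0 gcd0n; apply/eqP.
have [u v uv _] := egcdnP l.-1 k0.
have pow_u : 2 ^ (u * k) = 1 %[mod l].
  by rewrite mulnC expnM -modnXm pow_k modnXm exp1n.
have pow_v : 2 ^ (v * l.-1) = 1 %[mod l].
  by rewrite mulnC expnM -modnXm pow_l modnXm exp1n.
by rewrite -pow_u uv expnD -modnMml pow_v modnMml mul1n.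
Qed.

(** Each factor is at least 1 - 1 / l, so this is a form of Bernoulli's
    inequality. *)
Lemma prod_sub_ge (s : seq nat) (l : nat) :
    (0 < l)%N -> all (leq l) s ->
  1 - (size s)%:R / l%:R <= \prod_(p <- s) (1 - p%:R^-1 : rat).
Proof.
move=> l0; elim: s => [|p s IH] /=; first by rewrite big_nil mul0r subr0.
case/andP=> lp /IH {}IH; rewrite big_cons.
have l_pos : 0 < l%:R :> rat by rewrite ltr0n.
have p_pos : 0 < p%:R :> rat by rewrite ltr0n (leq_trans l0).
have p_inv : p%:R^-1 <= l%:R^-1 :> rat by rewrite lef_pV2 // ler_nat.
have p_inv0 : 0 <= p%:R^-1 :> rat by rewrite invr_ge0 ltW.
have p1 : p%:R^-1 <= 1 :> rat by rewrite invf_le1 // ler1n -(ltr0n rat).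
apply: le_trans (ler_wpM2l _ IH); last by rewrite subr_ge0.
have : 0 <= (size s)%:R / l%:R :> rat by rewrite divr_ge0 ?ler0n.
rewrite -natr1 mulrDl mul1r; move: (_ / _) => x x0.
have := mulr_ge0 p_inv0 x0; lra.
Qed.

Lemma totient_ratio (n : nat) : (0 < n)%N ->
  (totient n)%:R / n%:R = \prod_(p <- primes n) (1 - p%:R^-1 : rat).
Proof.
move=> n0; apply: (canLR (mulfK _)); first by rewrite pnatr_eq0 -lt0n.
have -> : n%:R = \prod_(p <- primes n) (p ^ logn p n)%:R :> rat.
  by rewrite {1}(prod_prime_decomp n0) prime_decompE big_map natr_prod.
rewrite (totientE n0) natr_prod -big_split /=; apply: eq_big_seq => p.
rewrite mem_primes => /and3P[p_pr _ p_n].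
have e0 : (0 < logn p n)%N by rewrite logn_gt0 mem_primes p_pr n0.
rewrite -{2}(prednK e0) expnS !natrM mulrA; congr (_ * _).
have p0 : p%:R != 0 :> rat by rewrite pnatr_eq0 -lt0n prime_gt0.
by rewrite mulrBl mul1r mulVf // -subn1 natrB // prime_gt0.
Qed.

Lemma exp_size_primes_le (n l : nat) : (0 < n)%N -> all (leq l) (primes n) ->
  (l ^ size (primes n) <= n)%N.
Proof.
move=> n0 l_le; rewrite {2}(prod_prime_decomp n0) prime_decompE big_map /=.
have : all (fun p => 0 < logn p n)%N (primes n) by apply/allP => p; rewrite logn_gt0.
elim: (primes n) l_le => [|p s IH] /=; first by rewrite big_nil.
case/andP=> lp /IH {}IH /andP[e0 /IH {}IH]; rewrite big_cons expnS leq_mul //.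
rewrite (leq_trans lp) // -{1}(expn1 p).
by case: p e0 lp => [|p] e0 lp; rewrite ?leq_pexp2l // exp0n.
Qed.

(** By [totient_ratio] and [prod_sub_ge], with w the number of prime divisors of
    q - 1 and l the least of them, theta q is at least 1 - w / l. *)
Lemma theta_ge (q : nat) : (1 < q)%N ->
  (9 * size (primes (q - 1)) <= pdiv (q - 1))%N -> 8%:R / 9%:R <= theta q.
Proof.
move=> q1; rewrite /theta; have := @totient_ratio (q - 1).
have [n n_eq] : exists n, n = (q - 1)%N by exists (q - 1)%N.
rewrite -n_eq; have {q1 n_eq q} n0 : (0 < n)%N by rewrite n_eq subn_gt0.
move=> /(_ n0) -> le_l.
have := @prod_sub_ge (primes n) (pdiv n) (pdiv_gt0 n).
have -> : all (leq (pdiv n)) (primes n).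
  apply/allP => p; rewrite mem_primes => /and3P[p_pr _ p_dvd].
  exact: pdiv_min_dvd (prime_gt1 p_pr) p_dvd.
have l_pos : 0 < (pdiv n)%:R :> rat by rewrite ltr0n pdiv_gt0.
have {le_l} : 9 * (size (primes n))%:R <= (pdiv n)%:R :> rat.
  by rewrite -natrM ler_nat.
move: (\prod_(_ <- _) _) l_pos => P; move: (size _)%:R (pdiv n)%:R => w l l_pos le_l.
move=> /(_ isT); apply: le_trans.
have : w / l <= 1 / 9 by rewrite ler_pdivrMr //; lra.
lra.
Qed.

(** With w the number of prime divisors of 2 ^ k - 1 and l > 2k the least of
    them, l ^ w < 2 ^ k. For k >= 11 one has l ^ 2 >= 23 ^ 2 > 2 ^ 9, so
    9 * w < 2 * k < l, and [theta_ge] applies. For k = 3 the ratio is 6/7 < 8/9. *)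
Lemma theta_ge_of_order (k : nat) : odd k -> k != 3%N ->
  (k.*2 < pdiv (2 ^ k - 1))%N -> 8%:R / 9%:R <= theta (2 ^ k).
Proof.
move=> k_odd k3 l_gt.
have k0 : (0 < k)%N by apply: odd_gt0.
apply: theta_ge; first by rewrite -{1}(expn0 2) ltn_exp2l.
have [k_lt | k_ge] := ltnP k 11.
  have : [|| k == 1, k == 5, k == 7 | k == 9]%N by lia.
  (* For k = 1 and k = 9 the hypothesis on the least prime fails: pdiv 1 = 1
     and pdiv 511 = 7; for k = 5 and k = 7 the number 2 ^ k - 1 is prime. *)
  by case/or4P => /eqP k_eq; move: l_gt; rewrite k_eq; vm_compute.
have n0 : (0 < 2 ^ k - 1)%N by rewrite subn_gt0 -{1}(expn0 2) ltn_exp2l.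
set w := size _; set l := pdiv _ in l_gt *.
have w_le : (l ^ w <= 2 ^ k - 1)%N.
  apply: exp_size_primes_le => //; apply/allP => p; rewrite mem_primes => /and3P[p_pr _ p_dvd].
  exact: pdiv_min_dvd (prime_gt1 p_pr) p_dvd.
have : (2 ^ (9 * w) < 2 ^ k.*2)%N.
  apply: (@leq_ltn_trans ((l ^ 2) ^ w)).
    have : (2 ^ 9 <= l ^ 2)%N by rewrite (leq_trans (n := 23 ^ 2)) // leq_exp2r //; lia.
    by rewrite expnM; case: w {w_le} => [|w] //; rewrite leq_exp2r.
  rewrite -expnM mulnC expnM -muln2 expnM ltn_exp2r //; lia.
rewrite ltn_exp2l //; lia.
Qed.

(** * The exceptional fields and the classification *)

(** Every nonzero element has (#|F| - 1)-th power equal to 1. This covers the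
    fields with 4 and 8 elements, where #|F| - 1 is prime. *)
Lemma no_NT_pair_all_units (F : finFieldType) (p : F * F) : ~ NT_pair #|F|.-1 p.
Proof.
case=> _ [x0 x1 [g xg]] _; move: x0 x1; rewrite xg.
have [->|g0] := eqVneq g 0; last by rewrite expf_card_pred ?eqxx.
by rewrite expr0n; case: (#|F|.-1 == 0)%N; rewrite eqxx.
Qed.

(** The nonzero cubes are the fifth roots of unity. If x and x + 1 are both among
    them, expanding (x + 1) ^+ 5 gives x ^+ 4 + x + 1 = 0, hence
    x ^+ 2 + x + 1 = 0, so x ^+ 3 = 1 and finally x = 1. *)
Lemma no_NT_pair_16 (F : finFieldType) (p : F * F) : #|F| = 16%N -> ~ NT_pair 3 p.
Proof.
move=> cF; have F2 : 2%N \in [pchar F] by apply: (@card_finPcharP _ 2 4).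
have two0 : 2%:R = 0 :> F by apply/eqP; rewrite -(dvdn_pcharf F2).
have cube (x : F) : nontrivial_power 3 x -> x ^+ 5 = 1.
  case=> x0 _ [g xg]; have g0 : g != 0 by apply: contraNneq x0 => g0; rewrite xg g0 expr0n.
  by rewrite xg -exprM; have := expf_card_pred g0; rewrite cF.
case: p => x y [/= -> x_pow /cube y5]; have x5 := cube _ x_pow; case: x_pow => _ /eqP x1 _; apply: x1.
have x4 : x ^+ 4 + x + 1 = 0.
  have expand : (x + 1) ^+ 5 = x ^+ 5 + (x ^+ 4 + x + 1)
      + 2%:R * (2%:R * x ^+ 4 + 5%:R * x ^+ 3 + 5%:R * x ^+ 2 + 2%:R * x) by ring.
  by move: y5; rewrite expand x5 two0 mul0r addr0 -[RHS]addr0 => /addrI.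
have x2 : x ^+ 2 + x + 1 = 0.
  transitivity (x * (x ^+ 4 + x + 1) - (x ^+ 5 - 1)); first by ring.
  by rewrite x4 x5 subrr mulr0 subr0.
have x3 : x ^+ 3 = 1.
  apply/eqP; rewrite -subr_eq0; apply/eqP.
  transitivity ((x - 1) * (x ^+ 2 + x + 1)); first by ring.
  by rewrite x2 mulr0.
have x_sqr : x ^+ 2 = 1 by rewrite -[LHS]mul1r -{1}x3 -exprD.
by move: x3; rewrite exprS x_sqr mulr1.
Qed.

Theorem theorem1p2 (q k : nat) (F : finFieldType)
    (hk : (1 <= k)%N) (hq : q = (2 ^ k)%N) (hF : #|F| = q)
    (htheta : theta q < 8%:R / 9%:R) :
  (exists p : F * F, NT_pair (pdiv (q - 1)) p) <->
  ~ (q = 4%N \/ q = 8%N \/ q = 16%N).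
Proof.
split=> [[p pair] exceptional | regular].
  have [q4 | [q8 | q16]] := exceptional.
  - by apply: (@no_NT_pair_all_units F p); rewrite hF q4; rewrite q4 in pair.
  - by apply: (@no_NT_pair_all_units F p); rewrite hF q8; rewrite q8 in pair.
  - by apply: (@no_NT_pair_16 F p); rewrite ?hF //; rewrite q16 in pair.
rewrite {}hq in hF htheta regular *; set l := pdiv _.
have k1 : k != 1%N.
  by apply: contraTneq htheta => ->; rewrite /theta; vm_compute.
have k_gt1 : (1 < k)%N by case: k k1 hk {hF htheta regular l} => [|[]].
have q_gt1 : (1 < 2 ^ k - 1)%N.
  by rewrite ltn_subRL -[(1 + 1)%N]/(2 ^ 1)%N ltn_exp2l.
have l_pr : prime l by apply: pdiv_prime.
have l_odd : odd l.
  by apply: dvdn_odd (pdiv_dvd _) _; rewrite oddB ?expn_gt0 // oddX eqn0Ngt hk.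
pose d := gcdn k l.-1.
have d0 : (0 < d)%N by rewrite gcdn_gt0 hk.
have l_dvd : (l %| 2 ^ d - 1)%N by apply: prime_dvd_pow2_gcd => //; apply: pdiv_dvd.
have /dvdnP[r k_eq] : (d %| k)%N := dvdn_gcdl _ _.
have [r_large | r_small] := ltnP 3 r.
  apply: (exists_NT_pair_large hk hF (prime_gt0 l_pr)).
  by rewrite hF k_eq fourth_power_bound.
have [r3 | r_ne3] := eqVneq r 3.
  by apply: exists_NT_pair_cubic l_dvd => //; rewrite hF k_eq r3.
have r0 : (0 < r)%N by case: (r) k_eq hk => // ->.
exfalso.
(* The cases r = 1 and r = 2 lead to q = 4, 8 or 16, or to theta >= 8/9. *)
have [k_odd | k_even] := boolP (odd k); last first.
  have d_eq : d = 2%N.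
    have l3 : l.-1 = 2%N by rewrite /l pdiv_even_exponent.
    apply/eqP; rewrite /d l3.
    by rewrite eqn_dvd dvdn_gcdr dvdn_gcd dvdnn dvdn2 k_even andbT.
  have [r1 | r2] : r = 1%N \/ r = 2%N by lia.
    by case: regular; left; rewrite k_eq r1 d_eq.
  by case: regular; right; right; rewrite k_eq r2 d_eq.
have r1 : r = 1%N.
  have : odd r by move: k_odd; rewrite k_eq oddM => /andP[].
  lia.
have k_ne3 : k != 3%N by apply/eqP => k3; apply: regular; rewrite k3; right; left.
have l_gt : (k.*2 < l)%N.
  have : (k.*2 %| l.-1)%N.
    rewrite -muln2 Gauss_dvd ?coprimen2 // dvdn2 -subn1 oddB ?prime_gt0 // l_odd andbT.
    have d_k : d = k by rewrite [RHS]k_eq r1 mul1n.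
    by rewrite subn1 -{1}d_k dvdn_gcdr.
  have : (1 < l)%N by apply: prime_gt1.
  move=> l1 /dvdn_leq; lia.
by move: htheta; rewrite ltNge theta_ge_of_order.
Qed.
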